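(* Let $G$ be an amenable discrete infinite countable group. Then for each nonsingular action $T=(T_g)_{g\in G}$ of $G$ on a standard probability space $(X,\mu)$ and each countable subset $\mathcal L$ of $L^1(X,\mu)$, there is a F{\o}lner sequence $(F_n)_{n=1}^\infty$ in $G$ such that $\bigcup_{n=1}^\infty F_n=G$ and for each $f\in\mathcal L$ there exists $$\lim_{n\to\infty}\frac{\sum_{g\in F_n}f(T_gx)\frac{d\mu\circ T_g}{d\mu}(x)}{\sum_{g\in F_n}\frac{d\mu\circ T_g}{d\mu}(x)}=E(f\mid\mathfrak T)(x)$$ at a.e. $x\in X$, where $\mathfrak T$ denotes the $\sigma$-algebra of $T$-invariant subsets in $X$.
   Context: A nonsingular action $T=(T_g)_{g\in G}$ on $(X,\mu)$ is a Borel action with $\mu\circ T_g\sim\mu$ (same null sets) for every $g\in G$. $E(\cdot\mid\mathfrak T)$ is the conditional expectation with respect to $\mu$. A F{\o}lner sequence in $G$ is a sequence of nonempty finite subsets $F_n\subset G$ with $\#(gF_n\triangle F_n)/\#F_n\to0$ for every $g\in G$. *)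

(* Defs.v *)
From HB Require Import structures.
From mathcomp Require Import all_boot all_order all_algebra finmap.
From mathcomp Require Import all_classical all_reals all_analysis.
From mathcomp Require Import measurable_realfun.
Set Implicit Arguments.
Unset Strict Implicit.
Unset Printing Implicit Defensive.
Import Order.TTheory GRing.Theory Num.Theory.
Import numFieldNormedType.Exports.
Local Open Scope classical_set_scope.
Local Open Scope ring_scope.

Section folner.
Context {G : groupType}.

Definition ltranslate (g : G) (A : {fset G}) : {fset G} :=
  [fset (g * h)%g | h in A]%fset.

Definition fsetY (A B : {fset G}) : {fset G} :=
  ((A `\` B) `|` (B `\` A))%fset.

Definition folner_sequence (R : realType) (F : nat -> {fset G}) : Prop :=
  (forall n, F n != fset0) /\
  forall g : G,
    ((#|` fsetY (ltranslate g (F n)) (F n)|%:R / #|` F n|%:R : R)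
      @[n --> \oo] --> (0 : R)).

End folner.

Arguments folner_sequence {G} R F.

(* For a countable discrete group, amenability means the existence of a
   Folner sequence of finite sets. *)
Definition amenable (R : realType) (G : groupType) : Prop :=
  exists F : nat -> {fset G}, folner_sequence R F.

(* (X, measurable) is Borel isomorphic to a Polish space. *)
Definition standard_borel (R : realType) d (X : measurableType d) : Prop :=
  exists (M : metricType R) (phi : X -> M),
    [/\ exists2 D : set M, countable D & dense D,
        forall F : set_system M, ProperFilter F -> cauchy F ->
          exists l : M, F --> l,
        bijective phi &
        forall A : set M, measurable (phi @^-1` A) <-> <<s open >> A].

Section conditional_expectation.
Context d (X : measurableType d) (R : realType) (mu : probability X R).

Definition is_condexp (S : set (set X)) (f h : X -> R) : Prop :=
  [/\ h \in Lfun mu 1,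
      forall B : set R, measurable B -> S (h @^-1` B) &
      forall A, S A ->
        (\int[mu]_(x in A) (h x)%:E = \int[mu]_(x in A) (f x)%:E)%E].

(* A chosen version; condexpP shows that one exists. *)
Definition condexp (S : set (set X)) (f : X -> R) : X -> R :=
  get (is_condexp S f).

Section condexp_exists.
Variables (S : set (set X)) (sS : sigma_algebra setT S).
Variables (Sm : S `<=` measurable) (f : X -> R).
Hypothesis intf : mu.-integrable setT (EFin \o f).

Let Y := g_sigma_algebraType S.

Let YE : (measurable : set (set Y)) = S.
Proof. exact: sigma_algebra_id. Qed.

Let Ym (A : set Y) : measurable A -> measurable (A : set X).
Proof. by rewrite YE => /Sm. Qed.

Let p : X -> Y := id.

Let mp : measurable_fun setT p.
Proof. by move=> _ A mA; rewrite setTI; exact: Ym. Qed.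

#[local] HB.instance Definition _ := isMeasurableFun.Build _ _ X Y p mp.

Let muS : probability Y R := distribution mu p.

Let nuS : set Y -> \bar R := induced_charge intf.

Let nuS0 : nuS set0 = 0%E.
Proof. exact: (charge0 (induced_charge intf)). Qed.

Let nuS_fin A : measurable A -> nuS A \is a fin_num.
Proof.
by move=> /Ym mA; exact: (@fin_num_measure _ _ _ (induced_charge intf) A mA).
Qed.

Let nuS_sigma_additive : semi_sigma_additive nuS.
Proof.
move=> F mF tF mUF.
apply: (@charge_semi_sigma_additive _ _ _ (induced_charge intf)) => //.
- by move=> n; exact: Ym.
- exact: Ym.
Qed.

#[local] HB.instance Definition _ := isCharge.Build _ _ _ nuS
  nuS0 nuS_fin nuS_sigma_additive.

Let nuS_dom : nuS `<< muS.
Proof.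
apply/null_content_dominatesP => A mA muA0.
apply: null_set_integral => //; first exact: Ym.
by apply: measurable_funTS; exact: (measurable_int mu intf).
Qed.

Local Open Scope charge_scope.

Let h : X -> R := fun x => fine (('d nuS '/d muS) x).

Let EFin_h : EFin \o h = 'd nuS '/d muS.
Proof. by apply/funext => x; rewrite /= fineK// Radon_Nikodym_fin_num. Qed.

Let rn_int : muS.-integrable setT ('d nuS '/d muS).
Proof. exact: Radon_Nikodym_integrable. Qed.

Let h_meas : measurable_fun setT (h : Y -> R).
Proof.
apply/measurable_EFinP; have -> : (EFin \o h : Y -> \bar R) = 'd nuS '/d muS.
  exact: EFin_h.
exact: measurable_int rn_int.
Qed.

Let h_int : mu.-integrable setT (EFin \o h).
Proof.
have mh : measurable_fun setT (h : X -> R).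
  exact: (measurableT_comp h_meas mp).
apply/integrableP; split; first exact/measurable_EFinP.
have /integrableP[m2 +] := rn_int; rewrite -EFin_h.
rewrite ge0_integral_pushforward//.
by apply: measurableT_comp => //; exact/measurable_EFinP.
Qed.

Lemma is_condexp_exists : exists h', is_condexp S f h'.
Proof.
exists h; split; first exact/Lfun1_integrable.
- by move=> B mB; rewrite -YE -[X in measurable X]setTI; exact: h_meas.
- move=> A; rewrite -YE => mA.
  have := Radon_Nikodym_integral nuS_dom mA; rewrite -EFin_h => eA.
  rewrite [RHS](_ : _ = nuS A)// eA integral_pushforward//.
  + exact/measurable_EFinP.
  + exact: (integrableS measurableT (Ym mA) (@subsetT _ A) h_int).
Qed.

End condexp_exists.

Lemma condexpP (S : set (set X)) (f : X -> R) :
  sigma_algebra setT S -> S `<=` measurable -> f \in Lfun mu 1 ->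
  is_condexp S f (condexp S f).
Proof.
move=> sS Sm /Lfun1_integrable intf; apply: getPex.
exact: is_condexp_exists.
Qed.

End conditional_expectation.

Section nonsingular_action.
Context d (X : measurableType d) (R : realType).

(* G is discrete and countable, so the action is Borel as soon as every T_g
   is. *)
Record nonsingular_action (G : groupType) (mu : probability X R) :=
  NonsingularAction {
    nsact :> G -> X -> X ;
    nsact1 : forall x, nsact 1%g x = x ;
    nsactM : forall g h x, nsact (g * h)%g x = nsact g (nsact h x) ;
    nsact_measurable : forall g, measurable_fun setT (nsact g) ;
    nsact_null : forall g A, measurable A ->
      (mu (nsact g @` A) = 0%E <-> mu A = 0%E) }.

Context (G : groupType) (mu : probability X R) (T : nonsingular_action G mu).

Definition measure_act (g : G) : set X -> \bar R := fun A => mu (T g @` A).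

Lemma image_nsact g (A : set X) : T g @` A = T g^-1%g @^-1` A.
Proof.
apply/seteqP; split => [_ [x Ax <-]|x Ax] /=.
  by rewrite -nsactM mulVg nsact1.
by exists (T g^-1%g x) => //; rewrite -nsactM mulgV nsact1.
Qed.

Section measure_act_measure.
Variable g : G.
Let nu := measure_act g.

Let nu0 : nu set0 = 0%E.
Proof. by rewrite /nu /measure_act image_set0 measure0. Qed.

Let nu_ge0 A : (0 <= nu A)%E.
Proof. exact: measure_ge0. Qed.

Let nu_sigma_additive : semi_sigma_additive nu.
Proof.
have -> : nu = pushforward mu (T g^-1%g).
  by apply/funext => A; rewrite /nu /measure_act image_nsact.
have mT := nsact_measurable T g^-1%g.
move=> F mF tF mUF; rewrite /pushforward preimage_bigcup.
apply: measure_semi_sigma_additive.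
- by move=> n; rewrite -[X in measurable X]setTI; exact: mT.
- apply/trivIsetP => /= i j _ _ ij; rewrite -preimage_setI.
  by move/trivIsetP : tF => /(_ _ _ _ _ ij) ->//; rewrite preimage_set0.
- by rewrite -preimage_bigcup -[X in measurable X]setTI; exact: mT.
Qed.

HB.instance Definition _ := isMeasure.Build _ _ _ (measure_act g)
  nu0 nu_ge0 nu_sigma_additive.

Let nu_fin : fin_num_fun nu.
Proof.
move=> A mA; rewrite /nu /measure_act image_nsact.
by apply: fin_num_measure; rewrite -[X in measurable X]setTI;
  exact: nsact_measurable.
Qed.

HB.instance Definition _ := Measure_isFinite.Build _ _ _ (measure_act g) nu_fin.

End measure_act_measure.

Lemma measure_act_dominates g : measure_act g `<< mu.
Proof.
by apply/null_content_dominatesP => A mA; exact: (nsact_null T g mA).2.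
Qed.

Local Open Scope charge_scope.

(* The values of the Radon-Nikodym derivative are finite, by
   measure_act_dominates and Radon_Nikodym_fin_num. *)
Definition rn_deriv (g : G) (x : X) : R :=
  fine (('d (charge_of_finite_measure (measure_act g)) '/d mu) x).

Definition invariant_sets : set (set X) :=
  [set A | measurable A /\ forall g, T g @` A = A].

Lemma sigma_algebra_invariant_sets : sigma_algebra setT invariant_sets.
Proof.
split.
- by split=> // g; rewrite image_set0.
- move=> A [mA TA]; rewrite setTD; split; first exact: measurableC.
  move=> g; have := TA g; rewrite !image_nsact => TgA.
  by rewrite -preimage_setC TgA.
- move=> F IF; split; first by apply: bigcup_measurable => n _; exact: (IF n).1.
  move=> g; rewrite image_bigcup; apply: eq_bigcupr => n _; exact: (IF n).2.
Qed.

Definition ratio_average (F : {fset G}) (f : X -> R) (x : X) : R :=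
  (\sum_(g <- F) f (T g x) * rn_deriv g x) / (\sum_(g <- F) rn_deriv g x).

End nonsingular_action.

(* Main.v *)
Require Import Defs.
From mathcomp Require Import all_boot all_order all_algebra finmap.
From mathcomp Require Import all_classical all_reals all_analysis.
From mathcomp Require Import measurable_realfun.
From mathcomp Require Import ring lra.

(** Write w_g (jac) for the density of mu o T_g with respect to mu, and for a
    finite set A of G put S_A f = sum_(g in A) (f o T_g) w_g (wsum).  The ratio
    in the theorem is S_A f / S_A 1 (wratio).

    Pointwise or maximal control of these ratios along a given Folner sequence
    can fail, but a Folner set A may be replaced by a right translate
    A a^-1, which has the same left-translation defects, and the choice of a
    is free.  The cocycle identity w_(gh) = (w_g o T_h) w_h shows that the ratio
    over A a^-1 at x is the ratio over A at T_(a^-1) x, and the change of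
    variables by T_a multiplies mu by w_a.  Summing over a in A therefore cancels
    the denominator S_A 1 and gives, for every f in L^1 (sum_integral_wratio),

      (1/#A) sum_(a in A) ||S_(A a^-1) f / S_(A a^-1) 1||_1 <= ||S_A f / #A||_1.

    So, if the right-hand side is small for finitely many f, then some translate
    has all the ratios small in L^1; since most a in A satisfy K a <= A for a
    given finite K, the translate can also be made to contain K
    (good_rtranslate, exists_good_set).

    The right-hand side tends to 0 along any Folner sequence as soon as
    E(f | invariant sets) = 0; this is the mean ergodic theorem (mean_ergodic).
    By duality ||S_A f||_1 / #A is the integral of f against the average over A
    of the functions psi o T_(a^-1), psi being the sign of S_A f.  That average
    is bounded by 1 and moves uniformly little under each fixed T_k.  If the
    norms did not tend to 0, the sets of functions that are bounded by 1, almost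
    invariant to a given precision, and of integral at least e against f would
    form a decreasing sequence of nonempty convex sets.  Near minimisers of the
    L^2 norm on them converge almost everywhere (midpoint_convex_chain_cvg) to
    an invariant function not orthogonal to f, which is absurd.

    Applied to f - E(f | invariant sets), for the f in an enumeration of the
    countable family, with errors summable in n, this gives sets F_n along which
    the L^1 norms of the ratios are summable, hence the ratios tend to 0 almost
    everywhere.  The conditional expectation is a T-invariant function, so the
    ratio of f is that of the difference plus E(f | invariant sets). *)

Import Order.TTheory GRing.Theory Num.Theory.
Import numFieldNormedType.Exports.
Local Open Scope classical_set_scope.
Local Open Scope ring_scope.
Set Implicit Arguments.
Unset Strict Implicit.
Unset Printing Implicit Defensive.

(** * Densities of a nonsingular action *)

Section density.
Context d (X : measurableType d) (R : realType) (G : groupType).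
Context (mu : probability X R) (T : nonsingular_action G mu).
Implicit Types (g h : G) (phi : X -> R).

Lemma nsactVK g : cancel (T g^-1%g) (T g).
Proof. by move=> x; rewrite -nsactM mulgV nsact1. Qed.

Lemma EFin_rn_deriv g x : (rn_deriv T g x)%:E =
  Radon_Nikodym (charge_of_finite_measure (measure_act T g)) mu x.
Proof. by rewrite fineK// Radon_Nikodym_fin_num//; exact: measure_act_dominates. Qed.

Lemma measurable_rn_deriv g : measurable_fun setT (rn_deriv T g).
Proof.
apply/measurable_EFinP; apply: (eq_measurable_fun
  (Radon_Nikodym (charge_of_finite_measure (measure_act T g)) mu)).
  by move=> x _; rewrite /= EFin_rn_deriv.
by apply: measurable_int; apply: Radon_Nikodym_integrable; exact: measure_act_dominates.
Qed.

Lemma rn_derivE g : {ae mu, forall x,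
  Radon_Nikodym_SigmaFinite.f (measure_act T g) mu x = (rn_deriv T g x)%:E}.
Proof.
have := ae_eq_Radon_Nikodym_SigmaFinite (measure_act_dominates T g) measurableT.
by apply: filterS => x /(_ I) ->; rewrite EFin_rn_deriv.
Qed.

Lemma rn_deriv_ge0 g : {ae mu, forall x, 0 <= rn_deriv T g x}.
Proof.
apply: filterS (rn_derivE g) => x e; rewrite -lee_fin -e.
by apply: Radon_Nikodym_SigmaFinite.f_ge0; exact: measure_act_dominates.
Qed.

(** The absolute value gives a version of the density that is nonnegative at
    every point, so that sums and quotients of densities need no almost
    everywhere care. *)
Definition jac g x : R := `|rn_deriv T g x|.

Lemma jac_ge0 g x : 0 <= jac g x. Proof. exact: normr_ge0. Qed.

Lemma measurable_jac g : measurable_fun setT (jac g).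
Proof. by apply: measurableT_comp => //; exact: measurable_rn_deriv. Qed.

Lemma ae_rn_deriv_jac g : {ae mu, forall x, rn_deriv T g x = jac g x}.
Proof. by apply: filterS (rn_deriv_ge0 g) => x x0; rewrite /jac ger0_norm. Qed.

Lemma ge0_integral_jac g phi : measurable_fun setT phi ->
  (forall x, 0 <= phi x) ->
  (\int[mu]_x (phi x * jac g x)%:E = \int[mu]_x (phi (T g^-1%g x))%:E)%E.
Proof.
move=> mphi phi0; have dom := measure_act_dominates T g.
have := @Radon_Nikodym_SigmaFinite.change_of_variables _ _ _ (measure_act T g)
  mu dom (EFin \o phi) setT _ measurableT.
move=> /(_ _ _)/= cov.
transitivity (\int[measure_act T g]_x (phi x)%:E)%E.
  rewrite -cov; [|by move=> x; rewrite lee_fin|by apply/measurable_EFinP].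
  apply: ge0_ae_eq_integral => //.
  - apply/measurable_EFinP; apply: measurable_funM => //; exact: measurable_jac.
  - apply: emeasurable_funM; first exact/measurable_EFinP.
    exact: measurable_int (Radon_Nikodym_SigmaFinite.f_integrable dom).
  - by move=> x _; rewrite lee_fin mulr_ge0 ?jac_ge0.
  - move=> x _; rewrite mule_ge0 ?lee_fin//.
    exact: Radon_Nikodym_SigmaFinite.f_ge0.
  - apply: filterS2 (rn_derivE g) (ae_rn_deriv_jac g) => x e1 e2 _.
    by rewrite e1 e2 EFinM.
have := @ge0_integral_pushforward _ _ X X R (T g^-1%g)
  (nsact_measurable T g^-1%g) mu setT (EFin \o phi) measurableT.
rewrite preimage_setT => /(_ _ _) <- //; last first.
- by move=> y _; rewrite lee_fin.
- by apply/measurable_EFinP.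
apply: eq_measure_integral => [|mT A mA _]; first exact: nsact_measurable.
by rewrite /= /measure_act image_nsact.
Qed.

Lemma integrable_jac g phi : measurable_fun setT phi ->
  mu.-integrable setT (fun x => (phi (T g^-1%g x))%:E) ->
  mu.-integrable setT (fun x => (phi x * jac g x)%:E).
Proof.
move=> mphi /integrableP[_ fin]; apply/integrableP; split.
  by apply/measurable_EFinP; apply: measurable_funM => //; exact: measurable_jac.
have /= e := ge0_integral_jac g (measurableT_comp (@normr_measurable _ setT) mphi)
  (fun=> normr_ge0 _).
under eq_integral do rewrite /= normrM [X in _ * X]ger0_norm ?jac_ge0//.
by rewrite e.
Qed.

Lemma integral_jac g phi : measurable_fun setT phi ->
  mu.-integrable setT (fun x => (phi (T g^-1%g x))%:E) ->
  (\int[mu]_x (phi x * jac g x)%:E = \int[mu]_x (phi (T g^-1%g x))%:E)%E.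
Proof.
move=> mphi iphi.
have jM (r s : R) : 0 <= s -> (Num.max (r * s) 0 = Num.max r 0 * s).
  by move=> s0; rewrite maxr_pMl// mul0r.
rewrite integralE [RHS]integralE; congr (_ - _)%E.
- transitivity (\int[mu]_x (phi^\+%R x * jac g x)%:E)%E.
    by apply: eq_integral => x _; rewrite funeposE -EFin_max jM ?jac_ge0.
  rewrite ge0_integral_jac; [|exact: measurable_funrpos|exact: funrpos_ge0].
  by apply: eq_integral => x _; rewrite funeposE -EFin_max.
- transitivity (\int[mu]_x (phi^\-%R x * jac g x)%:E)%E.
    apply: eq_integral => x _.
    by rewrite funenegE -EFinN -EFin_max -mulNr jM ?jac_ge0.
  rewrite ge0_integral_jac; [|exact: measurable_funrneg|exact: funrneg_ge0].
  by apply: eq_integral => x _; rewrite funenegE -EFinN -EFin_max.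
Qed.

Lemma integrable_jac1 g : mu.-integrable setT (EFin \o jac g).
Proof.
apply: (eq_integrable measurableT (fun x => (cst 1 x * jac g x)%:E)) => //.
  by move=> x _; rewrite /= mul1r.
apply: integrable_jac; first exact: measurable_cst.
exact: (finite_measure_integrable_cst _ 1).
Qed.

Lemma measurable_nsactT g phi : measurable_fun setT phi ->
  measurable_fun setT (fun x => phi (T g x)).
Proof. by move=> mphi; exact: measurableT_comp mphi (nsact_measurable T g). Qed.

(** Both sides have the same integral over every measurable E: changing
    variables once by T_(gh), or first by T_h and then by T_g, turns each of them
    into the measure of T_(gh) E. *)
Lemma jacM g h : {ae mu, forall x, jac (g * h)%g x = jac g (T h x) * jac h x}.
Proof.
have mj k := measurable_jac k.
have int_indic (E : set X) (f : X -> R) : measurable E ->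
    (\int[mu]_(x in E) (f x)%:E = \int[mu]_x (\1_E x * f x)%:E)%E.
  move=> mE; rewrite integral_mkcond; apply: eq_integral => x _.
  by rewrite epatch_indic /= muleC EFinM.
have cocycle : ae_eq mu setT (EFin \o jac (g * h)%g)
    (EFin \o (fun x => jac g (T h x) * jac h x)).
  apply: integral_ae_eq => //; first exact: integrable_jac1.
    by apply/measurable_EFinP; apply: measurable_funM => //; exact: measurable_nsactT.
  move=> E _ mE; have mE1 : measurable_fun setT (\1_E : X -> R) by [].
  rewrite (int_indic E)// [RHS](int_indic E)// ge0_integral_jac//.
  under [RHS]eq_integral do rewrite mulrA.
  rewrite (@ge0_integral_jac h (fun x => \1_E x * jac g (T h x))); last 2 first.
  - by apply: measurable_funM => //; exact: measurable_nsactT.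
  - by move=> x; rewrite mulr_ge0 ?jac_ge0.
  under [RHS]eq_integral do rewrite nsactVK.
  rewrite (@ge0_integral_jac g (fun x => \1_E (T h^-1%g x))) //; last first.
    exact: measurable_nsactT.
  by under [RHS]eq_integral do rewrite -nsactM -invgM.
by apply: filterS cocycle => x /(_ I) [].
Qed.

Lemma jac1 : {ae mu, forall x, jac 1%g x = 1}.
Proof.
have e : ae_eq mu setT (EFin \o jac 1%g) (cst 1%E).
  apply: integral_ae_eq => //; first exact: integrable_jac1.
  move=> E _ mE; rewrite integral_mkcond [RHS]integral_mkcond.
  rewrite !epatch_indic.
  transitivity (\int[mu]_x (\1_E x * jac 1%g x)%:E)%E.
    by apply: eq_integral => x _; rewrite /= muleC EFinM.
  rewrite ge0_integral_jac//; apply: eq_integral => x _.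
  by rewrite invg1 nsact1 /= mul1e.
by apply: filterS e => x /(_ I) [].
Qed.

(** The cocycle identity for g^-1 and g gives 1 = (w_(g^-1) o T_g) w_g. *)
Lemma jac_neq0 g : {ae mu, forall x, jac g x != 0}.
Proof.
apply: filterS2 (jacM g^-1%g g) jac1 => x; rewrite mulVg => + e1.
by rewrite e1; apply: contra_eq_neq => ->; rewrite mulr0 oner_eq0.
Qed.

End density.

(** * Weighted sums over finite sets and their right translates *)

Lemma measurable_invr (R : realType) : measurable_fun setT (@GRing.inv R).
Proof.
rewrite -(setvU [set (0 : R)]).
apply/(measurable_funU _ (measurableC _) _) => //; split; last exact: measurable_fun_set1.
apply: open_continuous_measurable_fun.
  by rewrite openC; exact: closed_eq.
move=> x; rewrite inE => /eqP x0; exact: inv_continuous.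
Qed.

Section averages.
Context d (X : measurableType d) (R : realType) (G : groupType).
Context (mu : probability X R) (T : nonsingular_action G mu).
Implicit Types (A : {fset G}) (f : X -> R).

Definition wsum A f x : R := \sum_(g <- A) f (T g x) * jac T g x.

Definition wratio A f x : R := wsum A f x / \sum_(g <- A) jac T g x.

Definition rtranslate A a : {fset G} := [fset (g * a^-1)%g | g in A]%fset.

Lemma sum_rtranslate A a (u : G -> R) :
  \sum_(g <- rtranslate A a) u g = \sum_(g <- A) u (g * a^-1)%g.
Proof. by rewrite big_imfset//= => b c _ _ /mulIg. Qed.

Lemma measurable_wsum A f : measurable_fun setT f ->
  measurable_fun setT (wsum A f).
Proof.
move=> mf; apply: measurable_sum => g; apply: measurable_funM.
- exact: measurable_nsactT.
- exact: measurable_jac.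
Qed.

Lemma measurable_wratio A f : measurable_fun setT f ->
  measurable_fun setT (wratio A f).
Proof.
move=> mf; apply: measurable_funM; first exact: measurable_wsum.
apply: measurableT_comp; first exact: measurable_invr.
apply: measurable_sum => g; exact: measurable_jac.
Qed.

Lemma wsum_rtranslate A a : {ae mu, forall x, forall f,
  wsum (rtranslate A a) f x = jac T a^-1%g x * wsum A f (T a^-1%g x)}.
Proof.
have /ae_foralln aeM n := jacM T (nth 1%g A n) a^-1%g.
apply: filterS aeM => x e f; rewrite /wsum sum_rtranslate mulr_sumr.
rewrite (big_nth 1%g) [RHS](big_nth 1%g); apply: eq_bigr => i _.
by rewrite nsactM e mulrA mulrC.
Qed.

(** The factor w_(a^-1)(x) that the cocycle identity extracts from numerator
    and denominator cancels.  The exceptional set does not depend on f. *)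
Lemma wratio_rtranslate A a : {ae mu, forall x, forall f,
  wratio (rtranslate A a) f x = wratio A f (T a^-1%g x)}.
Proof.
apply: filterS2 (wsum_rtranslate A a) (jac_neq0 T a^-1%g) => x e j0 f.
have sum1 (B : {fset G}) y : \sum_(g <- B) jac T g y = wsum B (cst 1) y.
  by apply: eq_bigr => g _; rewrite mul1r.
by rewrite /wratio !sum1 !e invfM mulrACA divff// mul1r.
Qed.

(** By the change of variables, the a-th integral is that of |S_A f / S_A 1| w_a,
    and the sum over a in A of the w_a is S_A 1.  This replaces a maximal
    inequality: it controls a well chosen translate of A, with constant 1. *)
Lemma sum_integral_wratio A f : measurable_fun setT f ->
  (\sum_(a <- A) \int[mu]_x `|wratio (rtranslate A a) f x|%:E
   <= \int[mu]_x `|wsum A f x|%:E)%E.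
Proof.
move=> mf.
have mr B : measurable_fun setT (fun x => `|wratio B f x|).
  by apply: measurableT_comp => //; exact: measurable_wratio.
have mrj a : measurable_fun setT (fun x => (`|wratio A f x| * jac T a x)%:E).
  by apply/measurable_EFinP/measurable_funM => //; exact: measurable_jac.
under eq_bigr => a _.
  rewrite (_ : integral _ _ _ =
    (\int[mu]_x (`|wratio A f x| * jac T a x)%:E)%E); last first.
    rewrite ge0_integral_jac//; apply: ge0_ae_eq_integral => //.
    - exact/measurable_EFinP.
    - apply/measurable_EFinP.
      exact: (measurable_nsactT T a^-1%g (mr A)).
    - by apply: filterS (wratio_rtranslate A a) => x ->.
  over.
rewrite -ge0_integral_sum//; last first.
  by move=> a x _; rewrite lee_fin mulr_ge0 ?jac_ge0.
apply: ge0_le_integral => //.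
- by move=> x _; apply: sume_ge0 => a _; rewrite lee_fin mulr_ge0 ?jac_ge0.
- exact: emeasurable_sum.
- by apply/measurable_EFinP/measurableT_comp => //; exact: measurable_wsum.
move=> x _; rewrite sumEFin lee_fin -mulr_sumr /wratio normrM -mulrA.
have J0 : 0 <= \sum_(a <- A) jac T a x by apply: sumr_ge0 => a _; exact: jac_ge0.
rewrite normfV (ger0_norm J0) ler_piMr//.
by have [->|J] := eqVneq (\sum_(a <- A) jac T a x) 0; rewrite ?mulr0// mulVf.
Qed.

End averages.

(** * Almost everywhere convergence *)

Section almost_everywhere_convergence.
Context d (X : measurableType d) (R : realType) (mu : probability X R).

Lemma bounded_integrable (f : X -> R) (M : R) : measurable_fun setT f ->
  (forall x, `|f x| <= M) -> mu.-integrable setT (EFin \o f).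
Proof.
move=> mf fM; apply: measurable_bounded_integrable => //.
  by rewrite -ge0_fin_numE ?fin_num_measure.
by exists M; split; [exact: num_real|move=> N MN x _; exact: le_trans (fM x) (ltW MN)].
Qed.

Lemma Rintegral_prob_cst (r : R) : (\int[mu]_x cst r x)%R = r.
Proof.
rewrite Rintegral_cst// -[RHS]mulr1; congr (_ * _).
by rewrite -[RHS]/(fine 1%E); congr fine; exact: probability_setT.
Qed.

(** The sum of the series has an integral at most c, hence is finite almost
    everywhere. *)
Lemma ae_cvg_normed_series (u : nat -> X -> R) (c : R) : 0 <= c ->
  (forall n, measurable_fun setT (u n)) ->
  (forall n, \int[mu]_x `|u n x|%:E <= (c / (2 ^ n.+1)%:R)%:E)%E ->
  {ae mu, forall x, cvgn [normed series (fun n => u n x)]}.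
Proof.
move=> c0 mu_ leu.
have mnu n : measurable_fun setT (fun x => `|u n x|%:E).
  by apply/measurable_EFinP/measurableT_comp.
have su x : (0 <= \sum_(0 <= n <oo) `|u n x|%:E)%E.
  by apply: nneseries_ge0 => n _ _; rewrite lee_fin.
have : mu.-integrable setT (fun x => \sum_(0 <= n <oo) `|u n x|%:E)%E.
  apply/integrableP; split; first exact: ge0_emeasurable_sum.
  under eq_integral do rewrite gee0_abs//.
  rewrite integral_nneseries//.
  apply: (@le_lt_trans _ _ c%:E); last exact: ltry.
  apply: le_trans (epsilon_trick0 xpredT c0).
  by apply: lee_nneseries => n _ //; rewrite integral_ge0.
move/(integrable_ae measurableT); apply: filterS => x /(_ I) xfin.
apply: nondecreasing_is_cvgn.
  by apply/nondecreasing_series => n _ _; exact: normr_ge0.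
exists (fine (\sum_(0 <= n <oo) `|u n x|%:E)%E) => _ [n _ <-].
rewrite -lee_fin fineK// /series/= -sumEFin.
by apply: nneseries_lim_ge => k _ _; rewrite lee_fin.
Qed.

(** The infima over Q n of the squared L^2 norm increase with n to a finite M.
    Functions chosen far in the chain with squared norm close to M are close to
    each other by the parallelogram identity, because their midpoint is still in
    some Q n whose infimum is close to M.  With errors 4^-j the successive
    distances in L^1 are at most a multiple of 2^-j. *)
Lemma midpoint_convex_chain_cvg (Q : nat -> set (X -> R)) :
  (forall n, Q n !=set0) ->
  (forall n, Q n.+1 `<=` Q n) ->
  (forall n f, Q n f -> measurable_fun setT f /\ forall x, `|f x| <= 1) ->
  (forall n f g, Q n f -> Q n g -> Q n (fun x => (f x + g x) / 2)) ->
  exists2 chi : nat -> X -> R, forall n, Q n (chi n) &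
    {ae mu, forall x, cvgn (fun n => chi n x)}.
Proof.
move=> Q0 Qdec Qb Qmid.
have Qle m n : (m <= n)%N -> Q n `<=` Q m.
  elim: n => [|n IH]; first by rewrite leqn0 => /eqP ->.
  rewrite leq_eqVlt => /predU1P[->//|/IH]; apply: subset_trans; exact: Qdec.
pose e (f : X -> R) := (\int[mu]_x (f x ^+ 2))%R.
have e0 f : 0 <= e f by apply: Rintegral_ge0 => x _; exact: sqr_ge0.
have isq n f : Q n f -> mu.-integrable setT (EFin \o (fun x => f x ^+ 2)).
  case/Qb => mf f1; apply: (@bounded_integrable _ 1).
    exact: measurable_funX.
  by move=> x; rewrite normrX exprn_ile1.
have e1 n f : Q n f -> e f <= 1.
  move=> Qf; rewrite -[leRHS]Rintegral_prob_cst.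
  apply: le_Rintegral => //; first exact: isq Qf.
    exact: (finite_measure_integrable_cst _ 1).
  by move=> x _; have [_ f1] := Qb _ _ Qf; rewrite -real_normK ?num_real// exprn_ile1.
pose c n := inf (e @` Q n).
have hlb n : has_inf (e @` Q n).
  split; first by have [f Qf] := Q0 n; exists (e f); exists f.
  by exists 0 => _ [f _ <-].
have c_le n f : Q n f -> c n <= e f.
  by move=> Qf; apply: ge_inf; [exact: (hlb n).2|exists f].
have c1 n : c n <= 1 by have [f Qf] := Q0 n; exact: le_trans (c_le _ _ Qf) (e1 _ _ Qf).
have hsc : has_sup (range c).
  by split; [exists (c 0%N); exists 0%N|exists 1 => _ [n _ <-]].
pose M := sup (range c).
pose del j : R := (4 ^ j)%:R^-1.
have del0 j : 0 < del j by rewrite invr_gt0 ltr0n expn_gt0.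
have near_min j : exists p : nat * (X -> R),
    [/\ (j <= p.1)%N, M - del j <= c p.1, Q p.1 p.2 & e p.2 <= M + del j].
  have [_ [m _ <-] Mm] := sup_adherent (del0 j) hsc.
  pose n := maxn j m.
  have [_ [f Qf <-] fn] := inf_adherent (del0 j) (hlb n).
  exists (n, f); split => //=; first exact: leq_maxl.
    apply: le_trans (ltW Mm) _; apply: lb_le_inf; first exact: (hlb n).1.
    by move=> _ [g Qg <-]; apply: c_le; apply: Qle Qg; exact: leq_maxr.
  apply: le_trans (ltW fn) _; rewrite lerD2r; apply: sup_ubound; first exact: hsc.2.
  by exists n.
have [p pP] := choice near_min.
pose chi j := (p j).2; exists chi.
  by move=> j; have [jp _ Qp _] := pP j; exact: Qle Qp.
pose t j x := chi j.+1 x - chi j x.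
have mchi j : measurable_fun setT (chi j).
  by have [_ _ /Qb[mf f1] _] := pP j.
have mt j : measurable_fun setT (t j) by exact: measurable_funB.
have chi1 j x : `|chi j x| <= 1 by have [_ _ /Qb[_ f1] _] := pP j; exact: f1.
have it j : mu.-integrable setT (EFin \o (fun x => `|t j x|)).
  apply: (@bounded_integrable _ 2); first exact: measurableT_comp.
  move=> x; rewrite normr_id; apply: le_trans (ler_normB _ _) _.
  by rewrite -[2]/(1 + 1) lerD.
have tle j : (\int[mu]_x `|t j x|%:E <= (9 / (2 ^ j.+1)%:R)%:E)%E.
  (* 2 |t| <= s t^2 + 1 / s with s = 2^j turns the L^2 bound into an L^1 bound;
     g is that majorant of |t|, with t^2 expanded by the parallelogram identity.
     Its integral is at most 4 s del j + 1 / (2 s) = 9 / (2 s). *)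
  pose mid x := (chi j x + chi j.+1 x) / 2.
  have delS : del j.+1 <= del j.
    by rewrite lef_pV2 ?posrE ?ltr0n ?expn_gt0// ler_nat leq_pexp2l.
  have [jp cj Qj ej] := pP j; have [jp1 cj1 Qj1 ej1] := pP j.+1.
  have [n Qmidn cn] : exists2 n, Q n mid & M - del j <= c n.
    have [le|/ltnW le] := leqP (p j).1 (p j.+1).1.
      by exists (p j).1 => //; apply: Qmid => //; exact: Qle Qj1.
    exists (p j.+1).1; first by apply: Qmid => //; exact: Qle Qj.
    by apply: le_trans cj1; rewrite lerD2l lerN2.
  have emid := le_trans cn (c_le _ _ Qmidn).
  pose s : R := (2 ^ j)%:R.
  have s0 : 0 < s by rewrite ltr0n expn_gt0.
  have dels : del j = (s ^+ 2)^-1 by rewrite /del /s -natrX -expnM mulnC expnM.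
  have iX m f : Q m f -> forall a : R,
      mu.-integrable setT (EFin \o (fun x => a * f x ^+ 2)).
    by move=> Qf a; exact: (integrableZl measurableT a (isq _ _ Qf)).
  rewrite [leLHS](_ : _ = (\int[mu]_x `|t j x|)%R%:E); last first.
    by rewrite /Rintegral fineK//; apply: (integrable_fin_num measurableT (it j)).
  rewrite lee_fin.
  pose g x := s * chi j x ^+ 2 + s * chi j.+1 x ^+ 2
              + (- (2 * s)) * mid x ^+ 2 + cst (2 * s)^-1 x.
  have i1 := iX _ _ Qj s; have i2 := iX _ _ Qj1 s.
  have i3 := iX _ _ Qmidn (- (2 * s)).
  have i4 : mu.-integrable setT (EFin \o cst (2 * s)^-1).
    exact: finite_measure_integrable_cst.
  have i12 := integrableD measurableT i1 i2.
  have i123 := integrableD measurableT i12 i3.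
  have eg : (\int[mu]_x g x)%R
      = s * e (chi j) + s * e (chi j.+1) - 2 * s * e mid + (2 * s)^-1.
    rewrite RintegralD//; congr (_ + _).
      rewrite RintegralD// RintegralD//; congr (_ + _ + _).
      + by rewrite RintegralZl//; exact: isq Qj.
      + by rewrite RintegralZl//; exact: isq Qj1.
      + by rewrite RintegralZl ?mulNr//; exact: isq Qmidn.
    exact: Rintegral_prob_cst.
  apply: (@le_trans _ _ (\int[mu]_x g x)%R).
    apply: le_Rintegral => //; first exact: (integrableD measurableT i123 i4).
    move=> x _; rewrite /g /t /mid /=.
    have := sqr_ge0 (s * `|chi j.+1 x - chi j x| - 1).
    have := real_normK (num_real (chi j.+1 x - chi j x)).
    set a := `|_|; set y := chi j x; set z := chi j.+1 x => eqa h.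
    rewrite -(ler_pM2l (mulr_gt0 (ltr0Sn R 1) s0)).
    rewrite [leRHS](_ : _ = s ^+ 2 * (z - y) ^+ 2 + 1); last by field; rewrite gt_eqF.
    by rewrite -eqa; nra.
  rewrite eg.
  have -> : (9 / (2 ^ j.+1)%:R) = s * (4 * del j) + (2 * s)^-1.
    by rewrite dels expnS natrM -/s; field; rewrite gt_eqF.
  rewrite lerD2r; nra.
have cvt := @ae_cvg_normed_series t 9 (ler0n _ _) mt tle.
apply: filterS cvt => x /normed_cvg.
rewrite (_ : series _ = fun n => chi n x - chi 0%N x); last first.
  exact: (telescopeK (fun n => chi n x)).
move=> cv; have cvc := is_cvgD cv (is_cvg_cst (chi 0%N x)).
rewrite (_ : (fun n => chi n x) =
  (fun n => chi n x - chi 0%N x) \+ (fun=> chi 0%N x)); first exact: cvc.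
by apply/funext => n /=; rewrite subrK.
Qed.

End almost_everywhere_convergence.

(** * Symmetric differences and integrals against invariant functions *)

Section symmetric_differences.
Context (G : groupType).
Implicit Types (A B : {fset G}).

Lemma mem_ltranslate (k g : G) A : (g \in ltranslate k A) = ((k^-1 * g)%g \in A).
Proof.
apply/imfsetP/idP => /= [[h hA ->]|gA]; first by rewrite mulKg.
by exists (k^-1 * g)%g => //; rewrite mulVKg.
Qed.

Lemma card_fsetY A B : #|` fsetY A B| = (#|` (A `\` B)%fset| + #|` (B `\` A)%fset|)%N.
Proof.
rewrite /fsetY cardfsU [X in (_ - X)%N](_ : _ = 0%N) ?subn0//.
apply/eqP; rewrite cardfs_eq0; apply/eqP.
by apply/fsetP => x; rewrite !inE; case: (x \in A); case: (x \in B).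
Qed.

Lemma ler_sumB_fsetY (R : realType) (u : G -> R) A B :
  (forall g, `|u g| <= 1) ->
  `|\sum_(g <- A) u g - \sum_(g <- B) u g| <= (#|` fsetY A B|)%:R.
Proof.
move=> u1.
have sumD (C D : {fset G}) : `|\sum_(g <- C | g \notin D) u g| <= (#|` (C `\` D)%fset|)%:R.
  apply: le_trans (ler_norm_sum _ _ _) _.
  apply: (@le_trans _ _ (\sum_(g <- C | g \notin D) 1)); first exact: ler_sum.
  rewrite big_const_seq iter_addr_0 ler_nat -size_filter.
  rewrite uniq_leq_size ?filter_uniq ?fset_uniq// => g.
  by rewrite mem_filter => /andP[gD gC]; rewrite in_fsetD gD.
have sumI : \sum_(g <- A | g \in B) u g = \sum_(g <- B | g \in A) u g.
  rewrite -big_filter -[RHS]big_filter; apply: perm_big.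
  apply: uniq_perm; rewrite ?filter_uniq ?fset_uniq// => g.
  by rewrite !mem_filter andbC.
rewrite (bigID (fun g => g \in B)) [\sum_(g <- B) _](bigID (fun g => g \in A))/=.
rewrite sumI opprD addrACA subrr add0r card_fsetY natrD.
by apply: le_trans (ler_normB _ _) _; rewrite lerD.
Qed.

End symmetric_differences.

Section invariant_functions.
Context d (X : measurableType d) (R : realType) (G : groupType).
Context (mu : probability X R) (T : nonsingular_action G mu).

Lemma integrableMbounded (f chi : X -> R) (M : R) :
  mu.-integrable setT (EFin \o f) -> measurable_fun setT chi ->
  (forall x, `|chi x| <= M) ->
  mu.-integrable setT (EFin \o (fun x => f x * chi x)).
Proof.
move=> intf mchi chiM; have mf : measurable_fun setT f.
  by apply/measurable_EFinP; exact: measurable_int intf.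
apply: (le_integrable measurableT _ _ (integrableZl measurableT M (integrable_abse intf))).
  by apply/measurable_EFinP; exact: measurable_funM.
move=> x _ /=; rewrite lee_fin normrM [leRHS]ger0_norm.
  by rewrite mulrC ler_wpM2r.
by rewrite mulr_ge0// (le_trans _ (chiM x)).
Qed.

(** The sum counts the steps 1, 2, ..., n that s has climbed, that is, it is the
    integer part of s. *)
Lemma staircase_approx n (s : R) : 0 <= s -> s <= n%:R ->
  `|s - \sum_(j < n) (j.+1%:R <= s)%R%:R| <= 1.
Proof.
move=> s0 sn.
suff : (n%:R <= s -> \sum_(j < n) (j.+1%:R <= s)%R%:R = n%:R :> R) /\
    (s <= n%:R -> `|s - \sum_(j < n) (j.+1%:R <= s)%R%:R| <= 1) by case=> _; exact.
elim: n {sn} => [|n [IHge IHle]].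
  by split=> [_|s0']; rewrite big_ord0// subr0 ger0_norm// (le_trans s0').
have nS : n%:R + 1 = n.+1%:R :> R by rewrite natr1.
rewrite big_ord_recr/=; split=> [ns|sn].
  by rewrite ns IHge ?natr1// (le_trans _ ns)// ler_nat.
have [ns|sn1] := leP n%:R s; last first.
  rewrite (_ : (n.+1%:R <= s) = false) ?addr0 ?IHle ?(ltW sn1)//.
  by apply/negbTE; rewrite -ltNge (lt_le_trans sn1)// ler_nat.
rewrite IHge//; case: (leP n.+1%:R s) => /= h; rewrite ler_norml; apply/andP; split; lra.
Qed.

(** The superlevel sets of chi are invariant, so f is orthogonal to their
    indicators, and chi is a uniform limit of combinations of these.  The scaled
    function s n = n (chi + 1) / 2 is within 1 of a sum of such indicators, so
    that n times the integral stays bounded. *)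
Lemma integral_invariant_eq0 (f chi : X -> R) :
  mu.-integrable setT (EFin \o f) ->
  (forall A, invariant_sets T A -> \int[mu]_(x in A) (f x)%:E = 0)%E ->
  measurable_fun setT chi -> (forall x, `|chi x| <= 1) ->
  (forall g x, chi (T g x) = chi x) ->
  (\int[mu]_x (f x * chi x))%R = 0.
Proof.
move=> intf f0 mchi chi1 chiT.
have mf : measurable_fun setT f.
  by apply/measurable_EFinP; exact: measurable_int intf.
pose s n x := n%:R * ((chi x + 1) / 2).
have ms n : measurable_fun setT (s n).
  apply: measurable_funM => //; apply: measurable_funM => //.
  exact: measurable_funD.
have chi_itv x : -1 <= chi x <= 1 by rewrite -ler_norml.
have s0 n x : 0 <= s n x.
  by rewrite mulr_ge0// mulr_ge0//; have /andP[] := chi_itv x; lra.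
have sn n x : s n x <= n%:R.
  by rewrite ler_piMr//; have /andP[] := chi_itv x; lra.
pose phi n x : R := \sum_(j < n) (j.+1%:R <= s n x)%R%:R.
pose B n j := [set x | j.+1%:R <= s n x].
have mB n j : measurable (B n j).
  rewrite (_ : B n j = s n @^-1` `[j.+1%:R, +oo[%classic).
    by rewrite -[X in measurable X]setTI; exact: ms.
  by apply/seteqP; split => x /=; rewrite /B /= in_itv/= andbT.
have phiE n x : phi n x = \sum_(j < n) \1_(B n j) x.
  apply: eq_bigr => j _; rewrite indicE; congr (nat_of_bool _)%:R.
  by apply/idP/idP; rewrite inE.
have mphi n : measurable_fun setT (phi n).
  rewrite (_ : phi n = fun x => \sum_(j < n) \1_(B n j) x); last exact/funext.
  by apply: measurable_sum => j; exact: measurable_indic.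
have iB n j : mu.-integrable setT (EFin \o (fun x => f x * \1_(B n j) x)).
  apply: (@integrableMbounded _ _ 1) => // x.
  by rewrite indicE; case: (_ \in _); rewrite ?normr1 ?normr0.
have intB n j : (\int[mu]_x (f x * \1_(B n j) x)%:E = 0)%E.
  rewrite -[RHS](f0 (B n j)).
    by rewrite [RHS]integral_mkcond epatch_indic; apply: eq_integral => x _.
  split=> // g; rewrite image_nsact; apply/seteqP.
  by split => x; rewrite /B /s /= chiT.
have iphi n : mu.-integrable setT (EFin \o (fun x => f x * phi n x)).
  apply: (@integrableMbounded _ _ n%:R) => // x.
  rewrite ger0_norm; last by apply: sumr_ge0.
  rewrite -[leRHS](_ : \sum_(j < n) 1 = _); last first.
    by rewrite sumr_const card_ord.
  by apply: ler_sum => j _; rewrite lern1 leq_b1.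
have int_phi n : (\int[mu]_x (f x * phi n x))%R = 0.
  rewrite /Rintegral; under eq_integral do rewrite phiE mulr_sumr -sumEFin.
  rewrite integral_sum//; first by rewrite big1.
  by move=> j; exact: iB.
have ichi : mu.-integrable setT (EFin \o (fun x => f x * chi x)).
  exact: (@integrableMbounded _ _ 1).
have is_ n : mu.-integrable setT (EFin \o (fun x => f x * s n x)).
  by apply: (@integrableMbounded _ _ n%:R) => // x; rewrite ger0_norm.
have int_s n : (\int[mu]_x (f x * s n x))%R = n%:R / 2 * (\int[mu]_x (f x * chi x))%R.
  transitivity (\int[mu]_x (n%:R / 2 * (f x * chi x) + n%:R / 2 * f x))%R.
    by apply: eq_Rintegral => x _; rewrite /s; field.
  rewrite RintegralD//; [|exact: (integrableZl measurableT _ ichi)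
                         |exact: (integrableZl measurableT _ intf)].
  rewrite !RintegralZl// [X in _ + _ * X](_ : _ = 0) ?mulr0 ?addr0//.
  by rewrite /Rintegral (f0 setT)//; split=> // g; rewrite image_nsact.
set I := (\int[mu]_x (f x * chi x))%R in int_s *.
have bound n : n%:R / 2 * `|I| <= (\int[mu]_x `|f x|)%R.
  rewrite -[X in X * _]ger0_norm ?divr_ge0// -normrM -int_s.
  rewrite -[X in `|X|]subr0 -(int_phi n) -RintegralB//.
  apply: le_trans (le_normr_Rintegral measurableT _) _.
    exact: (integrableB measurableT (is_ n) (iphi n)).
  apply: le_Rintegral => //.
  - exact: (integrable_abse (integrableB measurableT (is_ n) (iphi n))).
  - exact: (integrable_abse intf).
  - move=> x _; rewrite -mulrBr normrM ler_piMr//; exact: staircase_approx.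
apply/eqP; rewrite -normr_eq0; apply/negP => /negP I0.
have Igt0 : 0 < `|I| by rewrite lt_neqAle eq_sym I0 normr_ge0.
(* Any n > 2 ||f||_1 / |I| contradicts the bound. *)
have := bound (Num.truncn ((\int[mu]_x `|f x|)%R * 2 / `|I|)).+1.
apply/negP; rewrite -ltNge mulrAC ltr_pdivlMr// -ltr_pdivrMr//.
by exact: truncnS_gt.
Qed.

End invariant_functions.

(** * The mean ergodic theorem in L^1 *)

Section mean_ergodic.
Context d (X : measurableType d) (R : realType) (G : groupType).
Context (mu : probability X R) (T : nonsingular_action G mu).

Lemma integrable_wsum (A : {fset G}) (f : X -> R) :
  mu.-integrable setT (EFin \o f) ->
  mu.-integrable setT (EFin \o wsum T A f).
Proof.
move=> intf; have mf : measurable_fun setT f.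
  by apply/measurable_EFinP; exact: measurable_int intf.
apply: (eq_integrable measurableT
  (fun x => \sum_(g <- A) (f (T g x) * jac T g x)%:E)%E).
  by move=> x _; rewrite sumEFin.
apply: integrable_sum => // g _.
apply: (@integrable_jac _ _ _ _ _ T g (fun x => f (T g x))).
  exact: measurable_nsactT.
by under eq_fun do rewrite nsactVK.
Qed.

(** psi is the sign of S_A f; the change of variables by each T_a moves the
    action from f to psi. *)
Lemma integral_wsum_dual (A : {fset G}) (f : X -> R) :
  mu.-integrable setT (EFin \o f) ->
  exists psi : X -> R, [/\ measurable_fun setT psi, forall x, `|psi x| <= 1 &
    (\int[mu]_x `|wsum T A f x|)%R =
    (\int[mu]_x (f x * \sum_(a <- A) psi (T a^-1%g x)))%R].
Proof.
move=> intf; have mf : measurable_fun setT f.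
  by apply/measurable_EFinP; exact: measurable_int intf.
have mS := measurable_wsum T A mf.
pose P := [set x | 0 <= wsum T A f x].
have mP : measurable P.
  rewrite (_ : P = wsum T A f @^-1` `[0, +oo[%classic).
    by rewrite -[X in measurable X]setTI; exact: mS.
  by apply/seteqP; split => x /=; rewrite /P /= in_itv/= andbT.
pose psi x : R := 2 * \1_P x - 1.
have mpsi : measurable_fun setT psi.
  apply: measurable_funB => //; apply: measurable_funM => //.
have psi1 x : `|psi x| <= 1.
  by rewrite /psi indicE; case: (_ \in _) => /=; rewrite ler_norml; apply/andP; split; lra.
exists psi; split => //.
have iT g : mu.-integrable setT
    (fun x => (psi (T g^-1%g x) * f (T g (T g^-1%g x)))%:E).
  under eq_fun do rewrite nsactVK mulrC.
  apply: (@integrableMbounded _ _ _ mu f (fun x => psi (T g^-1%g x)) 1) => //.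
  exact: measurable_nsactT.
have mpf g : measurable_fun setT (fun x => psi x * f (T g x)).
  by apply: measurable_funM => //; exact: measurable_nsactT.
rewrite /Rintegral; congr fine.
transitivity (\int[mu]_x \sum_(g <- A) (psi x * f (T g x) * jac T g x)%:E)%E.
  apply: eq_integral => x _; rewrite sumEFin; congr EFin.
  transitivity (psi x * wsum T A f x).
    rewrite /psi indicE; case: (boolP (x \in P)) => [|/negP]; rewrite inE /P/= => S0.
      by rewrite ger0_norm//; lra.
    by rewrite ltr0_norm ?ltNge; [lra|exact/negP].
  by rewrite mulr_sumr; apply: eq_bigr => g _; rewrite mulrA.
rewrite integral_sum//; last first.
  by move=> g; exact: (@integrable_jac _ _ _ _ _ T g (fun x => psi x * f (T g x))).
transitivity (\sum_(g <- A) \int[mu]_x (f x * psi (T g^-1%g x))%:E)%E.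
  apply: eq_bigr => g _.
  rewrite (@integral_jac _ _ _ _ _ T g (fun x => psi x * f (T g x)))//.
  by apply: eq_integral => x _; rewrite nsactVK mulrC.
rewrite -integral_sum//; last first.
  move=> g; apply: (@integrableMbounded _ _ _ mu f _ 1) => //.
  exact: measurable_nsactT.
by apply: eq_integral => x _; rewrite mulr_sumr sumEFin.
Qed.

(** Composing the average over A with T_k gives the average over k^-1 A of the
    same bounded family. *)
Lemma average_almost_invariant (A : {fset G}) (psi : X -> R) (k : G) (x : X) :
  (forall y, `|psi y| <= 1) ->
  let chi y := (\sum_(a <- A) psi (T a^-1%g y)) / #|` A|%:R in
  `|chi (T k x) - chi x| <= #|` fsetY (ltranslate k^-1%g A) A|%:R / #|` A|%:R.
Proof.
move=> psi1 /=; rewrite -mulrBl normrM normfV normr_nat ler_wpM2r ?invr_ge0//.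
rewrite (_ : \sum_(a <- A) psi (T a^-1%g (T k x)) =
             \sum_(b <- ltranslate k^-1%g A) psi (T b^-1%g x)); last first.
  rewrite big_imfset/=; last by move=> a b _ _ /mulgI.
  by apply: eq_bigr => a _; rewrite -nsactM invgM invgK.
exact: (@ler_sumB_fsetY _ _ (fun b => psi (T b^-1%g x))).
Qed.

Lemma limn_sup_cvg_diff (u v : nat -> R) (M : R) :
  (forall n, `|u n| <= M) -> (forall n, `|v n| <= M) ->
  (fun n => u n - v n) @ \oo --> (0 : R) -> limn_sup u <= limn_sup v.
Proof.
move=> uM vM uv.
have bnd (w : nat -> R) N : (forall n, `|w n| <= N) -> bounded_fun w.
  move=> wN; exists N; split; first exact: num_real.
  by move=> K NK n _; exact: le_trans (wN n) (ltW NK).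
have -> : u = v \+ (fun n => u n - v n) by apply/funext => n /=; rewrite subrKC.
apply: le_trans (le_limn_supD (bnd _ _ vM) _) _.
  apply: (bnd _ (M + M)) => n; apply: le_trans (ler_normB _ _) _.
  by rewrite lerD.
by have [_ ->] := cvg_limn_inf_sup uv; rewrite addr0.
Qed.

Lemma normr_limn_sup_le (u : nat -> R) (M : R) :
  (forall n, `|u n| <= M) -> `|limn_sup u| <= M.
Proof.
move=> uM; have uMM n : - M <= u n <= M by rewrite -ler_norml.
have sups_itv n : - M <= sups u n <= M.
  apply/andP; split.
    apply: le_trans (_ : u n <= _); first by have /andP[] := uMM n.
    apply: sup_ubound; last by exists n => /=.
    by exists M => _ [k _ <-]; have /andP[] := uMM k.
  apply: ge_sup; first by exists (u n); exists n => /=.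
  by move=> _ [k _ <-]; have /andP[] := uMM k.
rewrite limn_supE; last first.
  exists M; split; first exact: num_real.
  by move=> K MK n _; exact: le_trans (uM n) (ltW MK).
rewrite ler_norml; apply/andP; split.
  apply: lb_le_inf; first by exists (sups u 0); exists 0%N.
  by move=> _ [n _ <-]; have /andP[] := sups_itv n.
apply: le_trans (_ : sups u 0 <= M); last by have /andP[] := sups_itv 0%N.
apply: ge_inf; last by exists 0%N.
by exists (- M) => _ [n _ <-]; have /andP[] := sups_itv n.
Qed.

(** Finitely many elements have code below m, so eventual properties can be
    required of all of them simultaneously. *)
Lemma near_code_lt (I : Type) (code : I -> nat) (P : I -> nat -> Prop) : injective code ->
  (forall g, \forall n \near \oo, P g n) ->
  forall m, \forall n \near \oo, forall g, (code g < m)%N -> P g n.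
Proof.
move=> code_inj nP; elim=> [|m IH]; first by apply: nearW => n g; rewrite ltn0.
have [[g0 g0m]|noc] := pselect (exists g, code g = m).
  near=> n => g; rewrite ltnS leq_eqVlt => /predU1P[gm|gm].
    have -> : g = g0 by apply: code_inj; rewrite gm.
    by near: n; exact: nP.
  by move: g gm; near: n.
near=> n => g; rewrite ltnS leq_eqVlt => /predU1P[gm|gm].
  by exfalso; apply: noc; exists g.
by move: g gm; near: n.
Unshelve. all: by end_near. Qed.

(** For contradiction the convex sets Q m collect the functions that are
    invariant up to 1/(m+1) under the elements of code below m and whose integral
    against f is at least e.  Invariance holds at every point rather than almost
    everywhere, so the upper limit chi of an almost everywhere convergent sequence
    chi_ m in Q m is invariant at every point and its superlevel sets are
    invariant sets. *)
Lemma mean_ergodic (F : nat -> {fset G}) (f : X -> R) (e : R) :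
  countable [set: G] -> folner_sequence R F ->
  mu.-integrable setT (EFin \o f) ->
  (forall A, invariant_sets T A -> \int[mu]_(x in A) (f x)%:E = 0)%E ->
  0 < e ->
  \forall n \near \oo,
    (\int[mu]_x `|wsum T (F n) f x|)%R <= e * #|` F n|%:R.
Proof.
move=> /countable_injP[code code_injT] [F0 Fk] intf f0 e0.
have code_inj : injective code by move=> g h; apply: code_injT; rewrite inE.
have mf : measurable_fun setT f.
  by apply/measurable_EFinP; exact: measurable_int intf.
have cF0 n : 0 < #|` F n|%:R :> R by rewrite ltr0n cardfs_gt0.
apply: contrapT => not_near.
pose Q m := [set chi : X -> R | [/\ measurable_fun setT chi,
  forall x, `|chi x| <= 1,
  forall g, (code g < m)%N -> forall x, `|chi (T g x) - chi x| <= m.+1%:R^-1 &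
  e <= (\int[mu]_x (f x * chi x))%R]].
have Qne m : Q m !=set0.
  have near_m : \forall n \near \oo, forall g, (code g < m)%N ->
      #|` fsetY (ltranslate g^-1%g (F n)) (F n)|%:R / #|` F n|%:R <= m.+1%:R^-1 :> R.
    apply: near_code_lt => // g.
    have /cvgrPdist_le /(_ m.+1%:R^-1) := Fk g^-1%g.
    rewrite invr_gt0 ltr0n => /(_ isT); apply: filterS => n.
    by rewrite sub0r normrN ger0_norm// divr_ge0.
  have [N _ Ninv] := near_m.
  have [n Nn bad] : exists2 n, (N <= n)%N &
      e * #|` F n|%:R < (\int[mu]_x `|wsum T (F n) f x|)%R.
    apply: contrapT => none; apply: not_near; exists N => // n /= Nn.
    by rewrite leNgt; apply/negP => bad; apply: none; exists n.
  have [psi [mpsi psi1 dual]] := integral_wsum_dual (F n) intf.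
  pose chi y := (\sum_(a <- F n) psi (T a^-1%g y)) / #|` F n|%:R.
  have msum : measurable_fun setT (fun y => \sum_(a <- F n) psi (T a^-1%g y)).
    by apply: measurable_sum => a; exact: measurable_nsactT.
  have sum1 y : `|\sum_(a <- F n) psi (T a^-1%g y)| <= #|` F n|%:R.
    apply: le_trans (ler_norm_sum _ _ _) _.
    apply: (@le_trans _ _ (\sum_(a <- F n) 1)); first exact: ler_sum.
    by rewrite big_const_seq iter_addr_0 count_predT.
  exists chi; split.
  - by apply: measurable_funM.
  - by move=> y; rewrite normrM normfV normr_nat ler_pdivrMr// mul1r.
  - move=> g gm x; apply: le_trans (average_almost_invariant _ _ _ psi1) _.
    exact: Ninv.
  - apply: ltW; rewrite -(ltr_pM2r (cF0 n)).
    rewrite (lt_le_trans bad)// dual mulrC -RintegralZl//; last first.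
      apply: (@integrableMbounded _ _ _ mu f chi 1) => //.
        exact: measurable_funM.
      by move=> y; rewrite normrM normfV normr_nat ler_pdivrMr// mul1r.
    rewrite le_eqVlt; apply/orP; left; apply/eqP; apply: eq_Rintegral => x _.
    by rewrite /chi; field; rewrite gt_eqF.
have Qdec m : Q m.+1 `<=` Q m.
  move=> chi [mchi chi1 chiT chie]; split => // g gm x.
  apply: le_trans (chiT g (ltnW gm) x) _.
  by rewrite lef_pV2 ?posrE ?ltr0n// ler_nat.
have Qmid m chi chi' : Q m chi -> Q m chi' -> Q m (fun x => (chi x + chi' x) / 2).
  have half (a b c : R) : `|a| <= c -> `|b| <= c -> `|(a + b) / 2| <= c.
    move=> ac bc; rewrite normrM [X in _ * X]ger0_norm ?invr_ge0//.
    by have := ler_normD a b; lra.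
  move=> [mchi chi1 chiT chie] [mchi' chi1' chiT' chie']; split.
  - by apply: measurable_funM => //; exact: measurable_funD.
  - by move=> x; exact: half.
  - move=> g gm x; rewrite (_ : _ - _ =
      ((chi (T g x) - chi x) + (chi' (T g x) - chi' x)) / 2); last by field.
    by apply: half; [exact: chiT|exact: chiT'].
  - have i := @integrableMbounded _ _ _ mu f chi 1 intf mchi chi1.
    have i' := @integrableMbounded _ _ _ mu f chi' 1 intf mchi' chi1'.
    rewrite (_ : (\int[mu]_x _)%R =
      (\int[mu]_x (2^-1 * (f x * chi x) + 2^-1 * (f x * chi' x)))%R); last first.
      by apply: eq_Rintegral => x _; field.
    rewrite RintegralD//; [|exact: (integrableZl measurableT _ i)
                           |exact: (integrableZl measurableT _ i')].
    rewrite !RintegralZl//; lra.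
have [chi_ Qchi cvgchi] := @midpoint_convex_chain_cvg _ X R mu Q Qne Qdec
  (fun n chi Qn => let: And4 m b _ _ := Qn in conj m b) Qmid.
have mchi_ n : measurable_fun setT (chi_ n) by case: (Qchi n).
have chi1 n x : `|chi_ n x| <= 1 by case: (Qchi n) => _ + _ _; exact.
pose chi x := limn_sup (chi_ ^~ x).
have mchi : measurable_fun setT chi.
  apply: measurable_fun_limn_sup => // x _.
  - by exists 1 => _ [n _ <-]; exact: le_trans (ler_norm _) (chi1 n x).
  - exists (-1) => _ [n _ <-]; have := chi1 n x.
    by rewrite ler_norml => /andP[].
have chib x : `|chi x| <= 1 by exact: normr_limn_sup_le.
have chi_diff g x : (fun n => chi_ n (T g x) - chi_ n x) @ \oo --> (0 : R).
  apply/cvgrPdist_le => r r0; near=> n.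
  rewrite sub0r normrN; have [_ _ Qinv _] := Qchi n.
  apply: le_trans (Qinv g _ x) _; first by near: n; exact: nbhs_infty_gt.
  by apply: ltW; near: n; exact: near_infty_natSinv_lt (PosNum r0).
have chiT g x : chi (T g x) = chi x.
  apply/eqP; rewrite eq_le; apply/andP; split.
    exact: (@limn_sup_cvg_diff _ _ 1).
  apply: (@limn_sup_cvg_diff _ _ 1) => //.
  rewrite (_ : (fun _ => _) = \- (fun n => chi_ n (T g x) - chi_ n x)).
    by rewrite -[X in _ --> X]oppr0; exact: cvgN.
  by apply/funext => n /=; rewrite opprB.
have intfchi := @integrableMbounded _ _ _ mu f chi 1 intf mchi chib.
have mfchi n : measurable_fun setT (fun x => (f x * chi_ n x)%:E).
  by apply/measurable_EFinP/measurable_funM.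
have [] := @dominated_convergence _ _ _ mu setT measurableT
  (fun n x => (f x * chi_ n x)%:E) (fun x => (f x * chi x)%:E)
  (fun x => `|f x|%:E) mfchi (measurable_int _ intfchi).
- apply: filterS cvgchi => x cvx _; apply/cvg_EFin; first exact: nearW.
  apply: cvgMr; rewrite /chi cvg_limn_supE//.
- exact: (integrable_abse intf).
- apply: aeW => x n _ /=; rewrite lee_fin normrM ler_piMr//.
move=> _ _ cvint.
have : (e%:E <= \int[mu]_x (f x * chi x)%:E)%E.
  rewrite -(cvg_lim _ cvint)//; apply: lime_ge; first by apply/cvg_ex; eexists; exact: cvint.
  apply: nearW => n; have [_ _ _ Qe] := Qchi n.
  rewrite -[leRHS]fineK ?lee_fin//.
  apply: (integrable_fin_num measurableT).
  exact: (@integrableMbounded _ _ _ mu f _ 1).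
rewrite -[leRHS]fineK; last exact: (integrable_fin_num measurableT intfchi).
rewrite lee_fin leNgt => /negP; apply.
by have := integral_invariant_eq0 intf f0 mchi chib chiT; rewrite /Rintegral => ->.
Unshelve. all: by end_near. Qed.

End mean_ergodic.

(** * Choice of the Folner sets *)

Section folner_selection.
Context d (X : measurableType d) (R : realType) (G : groupType).
Context (mu : probability X R) (T : nonsingular_action G mu).

Lemma card_rtranslate (a : G) (A : {fset G}) : #|` rtranslate A a| = #|` A|.
Proof. by rewrite card_imfset//=; exact: mulIg. Qed.

(** Left and right translations commute. *)
Lemma folner_rtranslate (k a : G) (A : {fset G}) :
  #|` fsetY (ltranslate k (rtranslate A a)) (rtranslate A a)| =
  #|` fsetY (ltranslate k A) A|.
Proof.
have mem_r g (B : {fset G}) : (g \in rtranslate B a) = ((g * a)%g \in B).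
  apply/imfsetP/idP => /= [[h hB ->]|gB]; first by rewrite mulgVK.
  by exists (g * a)%g => //; rewrite mulgK.
rewrite (_ : fsetY _ (rtranslate A a) = rtranslate (fsetY (ltranslate k A) A) a).
  exact: card_rtranslate.
apply/fsetP => g.
by rewrite mem_r /fsetY !in_fsetU !in_fsetD !mem_ltranslate !mem_r -mulgA.
Qed.

Lemma sum_notin_le (k : G) (A : {fset G}) :
  \sum_(a <- A) ((k * a)%g \notin A)%:R <=
  #|` fsetY (ltranslate k A) A|%:R :> R.
Proof.
have := @ler_sumB_fsetY _ R (fun g => (g \notin A)%:R) (ltranslate k A) A.
have -> : \sum_(g <- A) (g \notin A)%:R = 0 :> R.
  by rewrite big_seq big1// => g ->.
rewrite subr0 big_imfset/=; last by move=> b c _ _ /mulgI.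
move=> h; apply: le_trans (ler_norm _) (h _) => g.
by rewrite normr_nat lern1 leq_b1.
Qed.

(** The penalty J a adds the L^1 norms of the ratios over A a^-1 to the number of
    k in K with k a not in A.  Its sum over A is below delta #A, so J a < delta for
    some a; as delta <= 1, no k in K is counted. *)
Lemma good_rtranslate (A : {fset G}) (m : nat) (f : nat -> X -> R)
    (K : seq G) (delta : R) : delta <= 1 ->
  (forall i, mu.-integrable setT (EFin \o f i)) ->
  \sum_(i < m) (\int[mu]_x `|wsum T A (f i) x|)%R
    + \sum_(k <- K) #|` fsetY (ltranslate k A) A|%:R < delta * #|` A|%:R ->
  exists2 a, a \in A &
    (forall i, (i < m)%N ->
      \int[mu]_x `|wratio T (rtranslate A a) (f i) x|%:E <= delta%:E)%E /\
    (forall k, k \in K -> (k * a)%g \in A).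
Proof.
move=> delta1 intf small.
have mf i : measurable_fun setT (f i).
  by apply/measurable_EFinP; exact: measurable_int (intf i).
pose I a i := (\int[mu]_x `|wratio T (rtranslate A a) (f i) x|%:E)%E.
have I0 a i : (0 <= I a i)%E by exact: integral_ge0.
pose J a := (\sum_(i < m) I a i + \sum_(k <- K) ((k * a)%g \notin A)%:R%:E)%E.
have J0 a : (0 <= \sum_(k <- K) ((k * a)%g \notin A)%:R%:E :> \bar R)%E.
  by apply: sume_ge0 => k _; rewrite lee_fin.
have sumJ : (\sum_(a <- A) J a < (delta * #|` A|%:R)%:E)%E.
  apply: (@le_lt_trans _ _ (\sum_(i < m) (\int[mu]_x `|wsum T A (f i) x|)%R
    + \sum_(k <- K) #|` fsetY (ltranslate k A) A|%:R)%:E); last by rewrite lte_fin.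
  rewrite big_split/= EFinD; apply: leeD.
    rewrite exchange_big -sumEFin; apply: lee_sum => i _.
    apply: le_trans (sum_integral_wratio T A (mf i)) _.
    rewrite /Rintegral fineK//.
    apply: (integrable_fin_num measurableT).
    exact: (integrable_abse (integrable_wsum T A (intf i))).
  rewrite exchange_big -sumEFin; apply: lee_sum => k _.
  by rewrite sumEFin lee_fin; exact: sum_notin_le.
have [a aA Ja] : exists2 a, a \in A & (J a < delta%:E)%E.
  apply: contrapT => none; move: sumJ; apply/negP; rewrite -leNgt.
  rewrite (_ : (_ * _)%:E = \sum_(a <- A) delta%:E)%E; last first.
    rewrite sumEFin; congr EFin.
    by rewrite big_const_seq count_predT iter_addr_0 mulr_natr.
  rewrite big_seq [leRHS]big_seq; apply: lee_sum => a aA.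
  by rewrite leNgt; apply/negP => Ja; apply: none; exists a.
exists a => //; split.
- move=> i im; apply: ltW; apply: le_lt_trans Ja.
  apply: (@le_trans _ _ (\sum_(i < m) I a i)%E); last exact: leeDl.
  by rewrite (bigD1 (Ordinal im))//= leeDl// sume_ge0.
- move=> k kK; apply/negPn/negP => kaA; move: Ja; apply/negP; rewrite -leNgt.
  apply: (@le_trans _ _ 1%E); first by rewrite lee_fin.
  rewrite /J; apply: (@le_trans _ _ (\sum_(k <- K) ((k * a)%g \notin A)%:R%:E)%E).
    rewrite (big_rem k)//= kaA leeDl//.
    by apply: sume_ge0 => k' _; rewrite lee_fin.
  by rewrite leeDr// sume_ge0.
Qed.

Lemma enum_code_lt (code : G -> nat) : injective code ->
  forall m, exists K : seq G, forall g, (g \in K) = (code g < m)%N.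
Proof.
move=> code_inj; elim=> [|m [K KP]]; first by exists [::] => g; rewrite ltn0.
have [[g0 g0m]|noc] := pselect (exists g, code g = m).
  exists (g0 :: K) => g; rewrite inE KP ltnS [RHS]leq_eqVlt -g0m; congr orb.
  by apply/eqP/eqP => [->//|/code_inj].
exists K => g; rewrite KP ltnS [RHS]leq_eqVlt.
by case: eqP => // gm; exfalso; apply: noc; exists g.
Qed.

Lemma exists_good_set (F : nat -> {fset G}) (code : G -> nat)
    (f : nat -> X -> R) (n : nat) :
  injective code -> folner_sequence R F ->
  (forall i, mu.-integrable setT (EFin \o f i)) ->
  (forall i A, invariant_sets T A -> \int[mu]_(x in A) (f i x)%:E = 0)%E ->
  exists B : {fset G}, [/\ (1%g : G) \in B,
    forall g, (code g < n)%N ->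
      #|` fsetY (ltranslate g B) B|%:R / #|` B|%:R <= n.+1%:R^-1 :> R,
    forall g, (code g < n)%N -> g \in B &
    forall i, (i < n)%N ->
      (\int[mu]_x `|wratio T B (f i) x|%:E <= (1 / (2 ^ n.+1)%:R)%:E)%E].
Proof.
move=> code_inj FF intf f0; have [F0 Fk] := FF.
have G_countable : countable [set: G].
  by apply/countable_injP; exists code => g h _ _; exact: code_inj.
have [K KP] := enum_code_lt code_inj n.
pose delta : R := 1 / (2 ^ n.+1)%:R.
have delta0 : 0 < delta by rewrite divr_gt0// ltr0n expn_gt0.
(* The n norms and the size K defects are each at most eta #F; the successor in
   the denominator makes their sum strictly less than delta #F. *)
pose eta : R := Num.min (delta / (n + size K).+1%:R) n.+1%:R^-1.
have eta0 : 0 < eta by rewrite lt_min divr_gt0 ?ltr0n//= invr_gt0 ltr0n.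
have cF0 m : 0 < #|` F m|%:R :> R by rewrite ltr0n cardfs_gt0.
have near_erg : \forall m \near \oo, forall i, (i < n)%N ->
    (\int[mu]_x `|wsum T (F m) (f i) x|)%R <= eta * #|` F m|%:R.
  apply: (@near_code_lt _ id) => // i.
  exact: (mean_ergodic G_countable FF (intf i) (f0 i) eta0).
have near_fol : \forall m \near \oo, forall g, (code g < n)%N ->
    #|` fsetY (ltranslate g (F m)) (F m)|%:R <= eta * #|` F m|%:R.
  apply: near_code_lt => // g.
  have /cvgrPdist_le /(_ _ eta0) := Fk g; apply: filterS => m.
  by rewrite sub0r normrN ger0_norm ?divr_ge0// ler_pdivrMr.
have [N _ /(_ N (leqnn _)) [erg fol]] := filterI near_erg near_fol.
have [a aA [ratio_small KA]] : exists2 a, a \in F N &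
    (forall i, (i < n)%N ->
      \int[mu]_x `|wratio T (rtranslate (F N) a) (f i) x|%:E <= delta%:E)%E /\
    (forall k, k \in K -> (k * a)%g \in F N).
  apply: good_rtranslate => //.
    by rewrite ler_pdivrMr ?ltr0n ?expn_gt0// mul1r ler1n expn_gt0.
  apply: (@le_lt_trans _ _ ((n + size K)%:R * (eta * #|` F N|%:R))).
    rewrite natrD mulrDl lerD//.
      rewrite mulr_natl -[X in _ <= _ *+ X]card_ord -sumr_const.
      by apply: ler_sum => i _; exact: erg.
    rewrite -[leRHS](_ : \sum_(k <- K) eta * #|` F N|%:R = _); last first.
      by rewrite big_const_seq count_predT iter_addr_0 mulr_natl.
    by rewrite big_seq [leRHS]big_seq; apply: ler_sum => k; rewrite KP; exact: fol.
  rewrite mulrA ltr_pM2r// mulrC.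
  apply: (@lt_le_trans _ _ (eta * (n + size K).+1%:R)).
    by rewrite ltr_pM2l// ltr_nat.
  by rewrite -ler_pdivlMr ?ltr0n// ge_min lexx.
exists (rtranslate (F N) a); split.
- by apply/imfsetP; exists a => //=; rewrite mulgV.
- move=> g gn; rewrite folner_rtranslate card_rtranslate.
  rewrite ler_pdivrMr//; apply: le_trans (fol g gn) _.
  by rewrite ler_pM2r// ge_min lexx orbT.
- move=> g gn; apply/imfsetP; exists (g * a)%g; last by rewrite mulgK.
  by apply: KA; rewrite KP.
- exact: ratio_small.
Qed.

End folner_selection.

(** * The ratio theorem *)

Section invariant_condexp.
Context d (X : measurableType d) (R : realType) (G : groupType).
Context (mu : probability X R) (T : nonsingular_action G mu).

Lemma condexp_invariantP (f : X -> R) : f \in Lfun mu 1 ->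
  is_condexp mu (invariant_sets T) f (condexp mu (invariant_sets T) f).
Proof.
move=> fL; apply: condexpP => //; first exact: sigma_algebra_invariant_sets.
by move=> A [].
Qed.

(** The level set of the conditional expectation through x is an invariant set,
    so it contains T_g x. *)
Lemma condexp_nsact (f : X -> R) (g : G) (x : X) : f \in Lfun mu 1 ->
  condexp mu (invariant_sets T) f (T g x) = condexp mu (invariant_sets T) f x.
Proof.
move=> /condexp_invariantP[_ mh _]; set h := condexp _ _ _ in mh *.
have [_ inv] := mh [set h x] (measurable_set1 _).
have : (T g @` (h @^-1` [set h x])) (T g x) by exists x.
by rewrite inv.
Qed.

(** Since 1 is in B and w_1 = 1, the denominator does not vanish; an invariant
    function then has itself as ratio. *)
Lemma ratio_average_condexp (B : {fset G}) : (1%g : G) \in B ->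
  {ae mu, forall x, forall f, f \in Lfun mu 1 ->
    ratio_average T B f x =
      wratio T B (f \- condexp mu (invariant_sets T) f) x
        + condexp mu (invariant_sets T) f x}.
Proof.
move=> B1; have /ae_foralln ej n := ae_rn_deriv_jac T (nth 1%g B n).
apply: filterS2 ej (jac1 T) => x ej j1 f fL.
set h := condexp _ _ _.
have ejB g : g \in B -> rn_deriv T g x = jac T g x.
  by move=> gB; rewrite -(nth_index 1%g gB).
have J0 : \sum_(g <- B) jac T g x != 0.
  rewrite gt_eqF// (big_rem 1%g)//= j1 ltr_wpDr//.
  by apply: sumr_ge0 => g _; exact: jac_ge0.
have -> : ratio_average T B f x = wratio T B f x.
  rewrite /ratio_average /wratio /wsum.
  by congr (_ / _); rewrite big_seq [RHS]big_seq; apply: eq_bigr => g gB; rewrite ejB.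
rewrite /wratio -[X in _ + X](mulfK J0) -mulrDl; congr (_ / _).
rewrite mulr_sumr -big_split/=; apply: eq_bigr => g _.
by rewrite /h condexp_nsact// mulrBl subrK.
Qed.

End invariant_condexp.

Theorem theorem0p4 (R : realType) (G : groupType)
    (G_countable : countable [set: G]) (G_infinite : infinite_set [set: G])
    (G_amenable : amenable R G)
    (d : measure_display) (X : measurableType d) (X_standard : standard_borel R X)
    (mu : probability X R) (T : nonsingular_action G mu)
    (L : set (X -> R)) (L_countable : countable L)
    (L_L1 : forall f, L f -> f \in Lfun mu 1) :
  exists F : nat -> {fset G},
    [/\ folner_sequence R F,
        \bigcup_n [set` F n] = [set: G] &
        forall f, L f ->
          {ae mu, forall x, ratio_average T (F n) f x @[n --> \oo]
                            --> condexp mu (invariant_sets T) f x}].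
Proof.
have [F0 FF] := G_amenable.
have /countable_injP[code code_injT] := G_countable.
have code_inj : injective code by move=> g h; apply: code_injT; rewrite inE.
have [fs fsL Lfs] : exists2 fs : nat -> X -> R,
    forall i, fs i \in Lfun mu 1 & forall f, L f -> exists i, fs i = f.
  have /countable_injP[idx idx_inj] := L_countable.
  pose P i f := (f \in Lfun mu 1) /\ (forall g, L g -> idx g = i -> f = g).
  have /choice[fs fsP] : forall i, exists f, P i f.
    move=> i; have [[f [Lf fi]]|none] := pselect (exists f, L f /\ idx f = i).
      exists f; split; first exact: L_L1.
      by move=> g Lg gi; apply: idx_inj; rewrite ?inE// fi.
    exists (cst 0); split.
      by apply/Lfun1_integrable; exact: (finite_measure_integrable_cst _ 0).
    by move=> g Lg gi; exfalso; apply: none; exists g.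
  exists fs; first by move=> i; have [] := fsP i.
  by move=> f Lf; exists (idx f); have [_ e] := fsP (idx f); exact: e.
pose h i := condexp mu (invariant_sets T) (fs i).
pose phi i := fs i \- h i.
have ih i : mu.-integrable setT (EFin \o h i).
  by have [/Lfun1_integrable] := condexp_invariantP T (fsL i).
have ifs i : mu.-integrable setT (EFin \o fs i) by exact/Lfun1_integrable.
have iphi i : mu.-integrable setT (EFin \o phi i).
  exact: (integrableB measurableT (ifs i) (ih i)).
have phi0 i A : invariant_sets T A -> (\int[mu]_(x in A) (phi i x)%:E = 0)%E.
  move=> IA; have [mA _] := IA; have [_ _ /(_ A IA) hA] := condexp_invariantP T (fsL i).
  rewrite [LHS](integralB mA (integrableS measurableT mA (@subsetT _ _) (ifs i))
    (integrableS measurableT mA (@subsetT _ _) (ih i))).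
  rewrite -hA subee//; apply: (integrable_fin_num mA).
  exact: (integrableS measurableT mA (@subsetT _ _) (ih i)).
have /choice[F FP] n := @exists_good_set _ X R G mu T F0 code phi n code_inj FF iphi phi0.
exists F; split.
- split=> [n|g].
    by have [F1 _ _ _] := FP n; apply/fset0Pn; exists 1%g.
  apply/cvgrPdist_le => e e0; near=> n.
  rewrite sub0r normrN ger0_norm ?divr_ge0//.
  have [_ Fg _ _] := FP n.
  apply: le_trans (Fg g _) _; first by near: n; exact: nbhs_infty_gt.
  by apply: ltW; near: n; exact: near_infty_natSinv_lt (PosNum e0).
- apply/seteqP; split => // g _; exists (code g).+1 => //=.
  by have [_ _ Fg _] := FP (code g).+1; exact: Fg.
- move=> f Lf; have [i <-] := Lfs f Lf.
  (* The i-th function is controlled by F n only from n = i + 1 on. *)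
  pose u n x := if (i < n)%N then wratio T (F n) (phi i) x else 0.
  have mu_ n : measurable_fun setT (u n).
    rewrite /u; case: (i < n)%N => //; apply: measurable_wratio.
    by apply/measurable_EFinP; exact: measurable_int (iphi i).
  have leu n : (\int[mu]_x `|u n x|%:E <= (1 / (2 ^ n.+1)%:R)%:E)%E.
    rewrite /u; have [_ _ _ +] := FP n; move=> /(_ i); case: (i < n)%N; first exact.
    move=> _; rewrite integral0_eq ?lee_fin ?divr_ge0// => x _.
    by rewrite normr0.
  have /ae_foralln aeF n := ratio_average_condexp T (let: And4 F1 _ _ _ := FP n in F1).
  apply: filterS2 (ae_cvg_normed_series ler01 mu_ leu) aeF => x cvgu ratioE.
  have u0 : u ^~ x @ \oo --> 0.
    by apply: norm_cvg0; exact: cvg_series_cvg_0 cvgu.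
  rewrite -[X in _ --> X]add0r; apply: cvg_trans (cvgD u0 (cvg_cst (h i x))).
  apply: near_eq_cvg; near=> n; rewrite ratioE//.
  transitivity (u n x + h i x) => //.
  by rewrite /u ifT//; near: n; exact: nbhs_infty_gt.
Unshelve. all: by end_near. Qed.
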